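(* Let $H$ be a complex Hilbert space with $\dim H\ge 3$ (possibly infinite-dimensional), and let $k$ be an integer with $0<k<\dim H$ (any integer $k>0$ if $H$ is infinite-dimensional). Two $k$-dimensional subspaces $X,Y\subset H$ are compatible if and only if every geodesic of $\Gamma_k(H)$ connecting $X$ and $Y$ is a geodesic in $\Gamma^{\perp}_k(H)$.
   Context: Two $k$-dimensional subspaces of $H$ are adjacent if their intersection is $(k-1)$-dimensional (equivalently, their sum is $(k+1)$-dimensional). Two closed subspaces $X,Y\subset H$ are compatible if there is an orthonormal basis of $H$ such that $X$ and $Y$ are both spanned by subsets of this basis (equivalently, the orthogonal projections $P_X,P_Y$ commute). Two $k$-dimensional subspaces are ortho-adjacent if they are adjacent and compatible. The Grassmann graph $\Gamma_k(H)$ is the simple graph whose vertices are the $k$-dimensional subspaces of $H$ with edges joining adjacent subspaces; the ortho-Grassmann graph $\Gamma^{\perp}_k(H)$ has the same vertices, with edges joining ortho-adjacent subspaces. Both graphs are connected. In a connected simple graph, the distance $d(v,w)$ is the smallest length (number of edges) of a path connecting $v$ and $w$; a path connecting $v$ and $w$ is a geodesic if its length is $d(v,w)$. *)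

(* Defs.v *)
From HB Require Import structures.
From mathcomp Require Import all_boot all_order all_algebra.
From mathcomp Require Import complex.
From mathcomp Require Import all_classical all_reals all_analysis.

Set Implicit Arguments.
Unset Strict Implicit.
Unset Printing Implicit Defensive.

Import Order.TTheory GRing.Theory Num.Theory Num.Def.
Import numFieldNormedType.Exports.

Local Open Scope classical_set_scope.
Local Open Scope ring_scope.
Local Open Scope complex_scope.

(* Packing the canonical structure of R[i] keeps reverse coercions out of types. *)
Definition Cplx (R : realType) : numClosedFieldType := R[i].

(* inner is linear in its first argument and conjugate-linear in the second.
   The norm takes values in Cplx R (nonnegative reals there). *)
Record hilbertType (R : realType) := HilbertType {
  hilbert_space :> completeNormedModType (Cplx R);
  inner : {dot hilbert_space for conjC};
  normr_inner : forall x : hilbert_space, `|x| ^+ 2 = inner x x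
}.

Section Subspaces.
Variables (R : realType) (H : hilbertType R).
Implicit Types (X Y A B : set H) (n k : nat).

Definition lin_indep n (e : 'I_n -> H) : Prop :=
  forall c : 'I_n -> Cplx R, \sum_(i < n) c i *: e i = 0 -> forall i, c i = 0.

Definition lin_span A : set H :=
  smallest (fun W : set H => submod_closed [in W]) A.

Definition closed_span A : set H := closure (lin_span A).

Definition has_dim k X : Prop :=
  exists2 e : 'I_k -> H, lin_indep e & lin_span (range e) = X.

(* n <= dim H, including when H is infinite-dimensional. *)
Definition dim_ge n : Prop := exists e : 'I_n -> H, lin_indep e.

Definition orthonormal_set B : Prop :=
  forall u v, B u -> B v -> inner H u v = `[< u = v >]%:R.

(* An orthonormal basis in the Hilbert space sense: its span is only dense. *)
Definition orthonormal_basis B : Prop :=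
  orthonormal_set B /\ closed_span B = [set: H].

Definition compatible X Y : Prop :=
  exists2 B, orthonormal_basis B &
    (exists2 A, A `<=` B & closed_span A = X) /\
    (exists2 A, A `<=` B & closed_span A = Y).

End Subspaces.

Record grassmannian (R : realType) (H : hilbertType R) (k : nat) := Subspace {
  subspace_set :> set H;
  subspace_dim : has_dim k subspace_set
}.

(* With k = 0 the predecessor would make the only vertex adjacent to itself;
   the relations below are meant for 0 < k. *)
Definition adjacent (R : realType) (H : hilbertType R) (k : nat)
    (X Y : grassmannian H k) : Prop :=
  has_dim k.-1 (X `&` Y).

Definition ortho_adjacent (R : realType) (H : hilbertType R) (k : nat)
    (X Y : grassmannian H k) : Prop :=
  adjacent X Y /\ compatible X Y.

Definition grassmann_graph (R : realType) (H : hilbertType R) (k : nat) :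
  rel (grassmannian H k) := fun X Y => `[< adjacent X Y >].

Definition ortho_grassmann_graph (R : realType) (H : hilbertType R) (k : nat) :
  rel (grassmannian H k) := fun X Y => `[< ortho_adjacent X Y >].

Section Geodesics.
Variables (V : Type) (e : rel V).
Implicit Types (v w : V) (p : seq V).

(* The path has vertices v :: p, hence size p edges.  Repeated vertices are
   allowed, which changes neither the distance nor the geodesics. *)
Definition connecting_path v w p : Prop := path e v p /\ last v p = w.

Definition is_distance v w (d : nat) : Prop :=
  (exists2 p, connecting_path v w p & size p = d) /\
  (forall p, connecting_path v w p -> (d <= size p)%N).

Definition geodesic v w p : Prop :=
  connecting_path v w p /\ is_distance v w (size p).

End Geodesics.

(* Main.v *)
(* Compatibility of closed subspaces X and Y means that the part of X orthogonal
   to the intersection I of X and Y is orthogonal to Y: the required orthonormal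
   basis extends one of I, first to X and to Y, then to H.

   The distance of X and Y in the Grassmann graph is k - dim I.  On a geodesic,
   the vertex Z following X satisfies Z = (X & Z) + (Z & Y) and contains I, so
   that compatibility of X and Y passes to the pairs X, Z and Z, Y, and
   induction shows that the geodesic is a path of the ortho-Grassmann graph.

   Conversely, let x in X be orthogonal to I, and let y be in Y but not in X.
   The subspace spanned by y and the orthocomplement A of x in X comes next to X
   on some geodesic to Y and meets X in A; its compatibility with X forces y to
   be orthogonal to x. *)

From HB Require Import structures.
Require Import Defs.
From mathcomp Require Import all_boot all_order all_algebra.
From mathcomp Require Import complex.
From mathcomp Require Import all_classical all_reals all_analysis.
From mathcomp Require Import ring lra zify.

Set Implicit Arguments.
Unset Strict Implicit.
Unset Printing Implicit Defensive.

Import Order.TTheory GRing.Theory Num.Theory.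

(** * Closed subspaces of a Hilbert space *)

Section HilbertSpace.
Local Open Scope classical_set_scope.
Local Open Scope complex_scope.
Local Open Scope ring_scope.

Variables (R : realType) (H : hilbertType R).
Local Notation C := (Cplx R).
Implicit Types (u v w x y : H) (a b c : C) (W X Y A B : set H).
Local Notation "''[' u , v ]" := (inner H u v) : ring_scope.

(** * Sesquilinearity of the inner product *)

Lemma innerDl u v w : '[u + v, w] = '[u, w] + '[v, w].
Proof. by rewrite linearDl. Qed.
Lemma innerDr u v w : '[w, u + v] = '[w, u] + '[w, v].
Proof. by rewrite linearD. Qed.
Lemma innerZl a u v : '[a *: u, v] = a * '[u, v].
Proof. by rewrite linearZl_LR. Qed.
Lemma innerZr a u v : '[u, a *: v] = a^* * '[u, v].
Proof. by rewrite linearZr_LR. Qed.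
Lemma inner0l u : '[0, u] = 0.
Proof. by rewrite linear0l. Qed.
Lemma innerBl u v w : '[u - v, w] = '[u, w] - '[v, w].
Proof. by rewrite linearBl. Qed.
Lemma innerBr u v w : '[w, u - v] = '[w, u] - '[w, v].
Proof. by rewrite linearB. Qed.
Lemma innerC u v : '[u, v] = '[v, u]^*.
Proof. by rewrite hermC mul1r. Qed.
Lemma inner_eq0C u v : '[u, v] = 0 -> '[v, u] = 0.
Proof. by rewrite innerC => e; apply/eqP; rewrite -conjC_eq0 e. Qed.

(* These two maps fix the structures of [Cplx R]: the lemmas of complex.v are
   stated for another, only convertible, form of them. *)
Definition toC (r : R) : C := r%:C.
Definition ReC (c : C) : R := complex.Re c.

Lemma ReCK c : 0 <= c -> toC (ReC c) = c.
Proof. by move=> c0; exact: (RRe_real (ger0_real c0)). Qed.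

Lemma toC_inj : injective toC.
Proof. exact: complexI. Qed.

Lemma toCD r s : toC (r + s) = toC r + toC s.
Proof. exact: (rmorphD (real_complex R)). Qed.

Lemma toCM r s : toC (r * s) = toC r * toC s.
Proof. exact: (rmorphM (real_complex R)). Qed.

Lemma ltr_toC r s : (toC r < toC s) = (r < s).
Proof. exact: ltcR. Qed.

Lemma ler_toC r s : (toC r <= toC s) = (r <= s).
Proof. exact: lecR. Qed.

(** * The norm as a real number *)

(** Real values make infima and ordered-field tactics available. *)
Definition rnorm u : R := ReC `|u|.

Lemma rnormE u : `|u| = toC (rnorm u).
Proof. by rewrite ReCK. Qed.

Lemma rnorm_ge0 u : 0 <= rnorm u.
Proof. by rewrite -ler_toC -rnormE; exact: normr_ge0. Qed.

Lemma rnormD u v : rnorm (u + v) <= rnorm u + rnorm v.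
Proof. by rewrite -ler_toC toCD -!rnormE ler_normD. Qed.

Lemma rnorm_distC u v : rnorm (u - v) = rnorm (v - u).
Proof. by rewrite /rnorm distrC. Qed.

Lemma rnorm_sqr u : toC (rnorm u ^+ 2) = '[u, u].
Proof. by rewrite expr2 toCM -rnormE -expr2 normr_inner. Qed.

Lemma rnorm_eq0 u : rnorm u = 0 -> u = 0.
Proof. by move=> e; apply/eqP; rewrite -normr_eq0 rnormE e. Qed.

Lemma rnormZ a u : rnorm (a *: u) = ReC `|a| * rnorm u.
Proof. by apply: toC_inj; rewrite toCM -!rnormE ReCK // normrZ. Qed.

Lemma parallelogram u v :
  rnorm (u + v) ^+ 2 + rnorm (u - v) ^+ 2 = (rnorm u ^+ 2 + rnorm v ^+ 2) *+ 2.
Proof.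
apply: toC_inj; rewrite mulr2n !toCD !rnorm_sqr.
rewrite !(innerBl, innerBr) !(innerDl, innerDr).
by ring.
Qed.

Lemma pythagoras u v : '[u, v] = 0 ->
  rnorm (u + v) ^+ 2 = rnorm u ^+ 2 + rnorm v ^+ 2.
Proof.
move=> uv; apply: toC_inj; rewrite toCD !rnorm_sqr.
by rewrite !(innerDl, innerDr) uv (inner_eq0C uv) addr0 add0r.
Qed.

(** Balls of [H] have radii in [Cplx R]; a positive radius there is a real number, so real radii
    suffice. *)
Lemma closure_rnormP A x :
  closure A x <-> forall e : R, 0 < e -> exists2 y, A y & rnorm (x - y) < e.
Proof.
split=> [cAx e e0|h B /nbhs_ballP[e /= e0 eB]].
  have eC0 : 0 < toC e by rewrite -[0]/(toC 0) ltr_toC.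
  have [y [Ay]] := cAx _ (nbhsx_ballx x _ eC0).
  by rewrite -ball_normE /= rnormE ltr_toC => xy; exists y.
have [|y Ay xy] := h (ReC e); first by rewrite -ltr_toC ReCK ?ltW.
exists y; split=> //; apply: eB; rewrite -ball_normE /=.
by rewrite rnormE -(ReCK (ltW e0)) ltr_toC.
Qed.

(** * Subspaces, spans and orthocomplements *)

Definition subspace W := submod_closed [in W].

Lemma subspaceP W :
  subspace W <-> W 0 /\ forall a u v, W u -> W v -> W (a *: u + v).
Proof.
split=> -[W0 WD]; split.
- by move: W0; rewrite inE.
- by move=> a u v Wu Wv; have := WD a u v; rewrite !inE; apply.
- by rewrite inE.
- by move=> a u v; rewrite !inE; apply: WD.
Qed.

Lemma subspace0 W : subspace W -> W 0.
Proof. by case/subspaceP. Qed.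

Lemma subspaceZ W a u : subspace W -> W u -> W (a *: u).
Proof. by case/subspaceP=> W0 WD Wu; rewrite -[_ *: _]addr0; apply: WD. Qed.

Lemma subspaceD W u v : subspace W -> W u -> W v -> W (u + v).
Proof. by case/subspaceP=> W0 WD Wu; rewrite -[u]scale1r; apply: WD. Qed.

Lemma subspaceB W u v : subspace W -> W u -> W v -> W (u - v).
Proof.
by move=> sW Wu Wv; apply: subspaceD => //; rewrite -scaleN1r; apply: subspaceZ.
Qed.

Lemma subspaceT : subspace [set: H].
Proof. by apply/subspaceP. Qed.

Lemma subspaceI X Y : subspace X -> subspace Y -> subspace (X `&` Y).
Proof.
move=> /subspaceP[X0 XD] /subspaceP[Y0 YD]; apply/subspaceP; split=> //.
by move=> a u v [Xu Yu] [Xv Yv]; split; [apply: XD | apply: YD].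
Qed.

Definition orthocompl A : set H := [set x | forall y, A y -> '[x, y] = 0].

Lemma subspace_orthocompl A : subspace (orthocompl A).
Proof.
apply/subspaceP; split=> [y _|a u v Au Av y Ay]; first by rewrite inner0l.
by rewrite innerDl innerZl Au // Av // mulr0 addr0.
Qed.

Lemma subspace_lin_span A : subspace (lin_span A).
Proof.
apply/subspaceP; split=> [W [/subspaceP[]]//|a u v Au Av W [/= sW AW]].
by case/subspaceP: (sW) => _; apply; [apply: Au | apply: Av].
Qed.

Lemma sub_lin_span A : A `<=` lin_span A.
Proof. by move=> x Ax W [_]; apply. Qed.

Lemma lin_span_sub A W : subspace W -> A `<=` W -> lin_span A `<=` W.
Proof. by move=> sW AW x; apply. Qed.

Lemma subspace_closure W : subspace W -> subspace (closure W).
Proof.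
move=> sW; apply/subspaceP; split; first by apply: subset_closure; apply: subspace0.
move=> a u v /closure_rnormP cu /closure_rnormP cv; apply/closure_rnormP => e e0.
pose r := ReC `|a|; have r0 : 0 <= r by rewrite -ler_toC ReCK ?normr_ge0.
(* The divisor [r + 1], unlike [r], is positive also when [a = 0]. *)
have [|u' Wu' uu'] := cu (e / 2 / (r + 1)).
  by rewrite !divr_gt0 //; apply: ltr_wpDl.
have [|v' Wv' vv'] := cv (e / 2); first by lra.
exists (a *: u' + v'); first by apply: subspaceD => //; apply: subspaceZ.
rewrite opprD addrACA -scalerBr; apply: le_lt_trans (rnormD _ _) _.
rewrite rnormZ -/r.
have : r * rnorm (u - u') <= e / 2.
  apply: (@le_trans _ _ (r * (e / 2 / (r + 1)))).
    by apply: ler_wpM2l => //; apply: ltW.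
  by rewrite mulrA ler_pdivrMr; [nra | lra].
by move=> ?; lra.
Qed.

Lemma closed_span_sub A W : subspace W -> closed W -> A `<=` W -> closed_span A `<=` W.
Proof.
move=> sW cW AW; rewrite [X in _ `<=` X](closure_id W).1 //; apply: closure_subset.
exact: lin_span_sub.
Qed.

Lemma sub_closed_span A : A `<=` closed_span A.
Proof. by apply: subset_trans (@subset_closure _ _); apply: sub_lin_span. Qed.

Lemma subspace_closed_span A : subspace (closed_span A).
Proof. exact/subspace_closure/subspace_lin_span. Qed.

Lemma closed_closed_span A : closed (closed_span A).
Proof. exact: closed_closure. Qed.

(** For [y] in [A], let [c *: y] be the component of [x] along [y]. By Pythagoras every vector of
    the orthocomplement is at distance at least [rnorm (c *: y)] from [x], so a limit point has
    [c *: y = 0]. *)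
Lemma closed_orthocompl A : closed (orthocompl A).
Proof.
move=> x /closure_rnormP cx y Ay.
have [->|y0] := eqVneq y 0; first by rewrite innerC inner0l conjC0.
pose c := '[x, y] / '[y, y].
have yy : '[y, y] != 0 by rewrite dnorm_eq0.
have cy : '[x - c *: y, y] = 0 by rewrite innerBl innerZl divfK // subrr.
have /rnorm_eq0/eqP : rnorm (c *: y) = 0.
  apply/eqP; rewrite eq_le rnorm_ge0 andbT leNgt; apply/negP=> c0.
  have [z Az] := cx _ c0; rewrite ltNge => /negP[].
  rewrite -(@ler_pXn2r _ 2) ?nnegrE ?rnorm_ge0//.
  have -> : x - z = c *: y + (x - c *: y - z) by rewrite addrA [c *: y + _]addrC subrK.
  rewrite pythagoras ?lerDl ?sqr_ge0 //; apply: inner_eq0C.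
  by rewrite innerZr innerBl cy Az // subrr mulr0.
rewrite scaler_eq0 (negbTE y0) orbF mulf_eq0 invr_eq0 (negbTE yy) orbF.
by move/eqP.
Qed.

(** * Orthogonal projection, orthonormal bases and compatibility *)

(** A sequence in [W] minimizing the distance to [x] is Cauchy by the parallelogram law. Its limit
    [w] attains the minimum, which forces [x - w] to be orthogonal to [W]. *)
Lemma closed_projection W x : subspace W -> closed W ->
  exists2 w, W w & orthocompl W (x - w).
Proof.
move=> sW cW; pose D := [set rnorm (x - w) | w in W]; pose d := inf D.
have infD : has_inf D.
  split; first by exists (rnorm (x - 0)), 0 => //; apply: subspace0.
  by exists 0 => _ [w _ <-]; apply: rnorm_ge0.
have d_le w : W w -> d <= rnorm (x - w).
  by move=> Ww; apply: ge_inf; [case: infD | exists w].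
have d0 : 0 <= d by apply: lb_le_inf; [case: infD | move=> _ [w _ <-]; apply: rnorm_ge0].
(* The parallelogram law is applied to [x - w] and [x - w']: half their sum is [x] minus the
   midpoint of [w] and [w'], which lies in [W], so its norm is at least [d]. *)
have close w w' r : W w -> W w' -> rnorm (x - w) <= r -> rnorm (x - w') <= r ->
    rnorm (w - w') ^+ 2 <= 4 * (r ^+ 2 - d ^+ 2).
  move=> Ww Ww' wr wr'; have := parallelogram (x - w) (x - w').
  have -> : (x - w) - (x - w') = w' - w by rewrite opprB addrC addrA subrK.
  rewrite [rnorm (w' - w)]rnorm_distC.
  have -> : (x - w) + (x - w') = 2 *: (x - 2^-1 *: (w + w')).
    rewrite scalerBr scalerA divff ?pnatr_eq0 // scale1r scaler_nat mulr2n opprD.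
    by rewrite addrACA.
  have : d <= rnorm (x - 2^-1 *: (w + w')).
    by apply: d_le; apply: subspaceZ => //; apply: subspaceD.
  have := rnorm_ge0 (x - w); have := rnorm_ge0 (x - w').
  rewrite rnormZ; have -> : ReC `|2 : C| = 2.
    by apply: toC_inj; rewrite ReCK // ger0_norm ?ler0n // [in RHS]mulr2n toCD.
  rewrite mulr2n; nra.
have /choice[f fP] n : exists w, W w /\ rnorm (x - w) < d + n.+1%:R^-1.
  have [|_ [w Ww <-] wd] := @inf_adherent _ D n.+1%:R^-1 _ infD; first by [].
  by exists w.
have f_cauchy : cauchy (f @ \oo).
  apply: cauchy_exP => e e0.
  pose r := ReC e; have r0 : 0 < r by rewrite -ltr_toC ReCK // ltW.
  (* Since [t <= 1], the bound of [close] at [d + t] is at most [t (8 d + 4)], which is strictly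
     below [t (8 d + 5) <= r ^+ 2]. *)
  pose t := Num.min 1 (r ^+ 2 / (8 * d + 5)).
  have t0 : 0 < t by rewrite lt_min ltr01 divr_gt0 ?exprn_gt0 //; lra.
  have [N _ NP] := near_infty_natSinv_lt (PosNum t0).
  exists (f N); exists N => // n /= Nn; rewrite -ball_normE /=.
  rewrite rnormE -(ReCK (ltW e0)) ltr_toC -/r.
  have [WN fN] := fP N; have [Wn fn] := fP n.
  have tN := NP N (leqnn N); have tn := NP n Nn; rewrite /= in tN tn.
  have := close _ _ (d + t) WN Wn; rewrite (ltW (lt_trans fN _)) ?ltrD2l //.
  rewrite (ltW (lt_trans fn _)) ?ltrD2l // => /(_ isT isT).
  have t1 : t <= 1 by rewrite ge_min lexx.
  have : t * (8 * d + 5) <= r ^+ 2 by rewrite -ler_pdivlMr ?ge_min ?lexx ?orbT //; lra.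
  have := rnorm_ge0 (f N - f n); nra.
have /cauchy_cvgP/cvg_ex[w fw] := f_cauchy.
have w_near (e : R) : 0 < e -> \forall n \near \oo, rnorm (w - f n) < e.
  move=> e0; have eC0 : 0 < toC e by rewrite -[0]/(toC 0) ltr_toC.
  have /cvgrPdist_lt/(_ _ eC0) := fw; apply: filterS => n /=.
  by rewrite rnormE ltr_toC.
have Ww : W w.
  apply: cW; apply/closure_rnormP => e /w_near[N _ /(_ N (leqnn N)) wN].
  by exists (f N) => //; case: (fP N).
have wd : rnorm (x - w) <= d.
  suff wd (e : R) : 0 < e -> rnorm (x - w) <= d + e by apply/ler_addgt0Pr.
  move=> e0; have e2 : 0 < e / 2 by lra.
  have [N _ NP] := filterI (w_near _ e2) (near_infty_natSinv_lt (PosNum e2)).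
  have [/= wN eN] := NP N (leqnn N); rewrite /= in eN; have [_ fN] := fP N.
  have -> : x - w = (x - f N) + (f N - w) by rewrite addrA subrK.
  apply: le_trans (rnormD _ _) _; rewrite [rnorm (f N - w)]rnorm_distC.
  have := lt_trans fN (etrans (ltrD2l d _ _) eN); lra.
exists w => // u Wu; have [->|u0] := eqVneq u 0; first by rewrite innerC inner0l conjC0.
have uu : '[u, u] != 0 by rewrite dnorm_eq0.
(* [c *: u] is the component of [x - w] along [u]; moving [w] by it would bring it strictly closer
   to [x] unless this component vanishes. *)
pose c := '[x - w, u] / '[u, u].
have /pythagoras : '[x - (w + c *: u), c *: u] = 0.
  by rewrite opprD addrA innerZr innerBl innerZl divfK // subrr mulr0.
rewrite opprD addrA subrK -addrA -opprD => e.
have : d <= rnorm (x - (w + c *: u)).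
  by apply: d_le; apply: subspaceD => //; apply: subspaceZ.
have := rnorm_ge0 (x - w); have := rnorm_ge0 (c *: u) => c0 xw0 dle.
have : rnorm (c *: u) ^+ 2 <= 0 by nra.
rewrite exprn_even_le0 //= => /eqP/rnorm_eq0/eqP.
by rewrite scaler_eq0 (negbTE u0) orbF mulf_eq0 invr_eq0 (negbTE uu) orbF => /eqP.
Qed.

Lemma sub_orthocompl A B : A `<=` B -> orthocompl B `<=` orthocompl A.
Proof. by move=> AB x Bx y /AB; apply: Bx. Qed.

(** The vectors orthogonal to a given [x] form a closed subspace, which contains [closed_span A] as
    soon as it contains [A]. *)
Lemma orthocompl_closed_span A : orthocompl (closed_span A) = orthocompl A.
Proof.
apply/seteqP; split; first exact/sub_orthocompl/sub_closed_span.
move=> x Ax y; suff sub : closed_span A `<=` orthocompl [set x].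
  by move=> /sub /(_ x erefl) /inner_eq0C.
apply: closed_span_sub (subspace_orthocompl _) (@closed_orthocompl _) _.
by move=> z Az _ ->; apply/inner_eq0C/Ax.
Qed.

Lemma orthocompl_self x : orthocompl [set x] x -> x = 0.
Proof. by move=> /(_ x erefl)/eqP; rewrite dnorm_eq0 => /eqP. Qed.

(** By Zorn's lemma there is a maximal orthonormal extension inside [W]. If its closed span missed
    some [x] of [W], the normalized difference of [x] and its projection could be added. *)
Lemma orthonormal_extend W A : subspace W -> closed W -> orthonormal_set A ->
  A `<=` W -> exists B, [/\ orthonormal_set B, A `<=` B & closed_span B = W].
Proof.
move=> sW cW oA AW.
(* [B] is the part to be added to [A], so that the union of the empty chain, which is empty,
   satisfies [P]. *)
pose P := [set B | orthonormal_set (A `|` B) /\ B `<=` W].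
have chain F : F `<=` P -> total_on F subset -> P (\bigcup_(B in F) B).
  move=> FP totF; split; last by move=> u [B /FP[_ BW] Bu]; apply: BW.
  move=> u v [Au|[B FB Bu]] [Av|[B' FB' Bv]]; first exact: oA.
  - by case: (FP _ FB') => oB' _; apply: oB'; [left | right].
  - by case: (FP _ FB) => oB _; apply: oB; [right | left].
  - case: (totF _ _ FB FB') => [/(_ _ Bu) Bu'|/(_ _ Bv) Bv'].
      by case: (FP _ FB') => oB' _; apply: oB'; right.
    by case: (FP _ FB) => oB _; apply: oB; right.
have [B [[oB BW] maxB]] := Zorn_bigcup chain.
exists (A `|` B); split=> //.
have AB_W : A `|` B `<=` W by move=> u [/AW|/BW].
apply/seteqP; split; first exact: closed_span_sub.
move=> x Wx; apply: contrapT => nx.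
have [w Sw ow] := closed_projection x (subspace_closed_span (A `|` B))
  (@closed_closed_span _).
have Ww : W w by apply: closed_span_sub Sw.
have v0 : x - w != 0 by apply/eqP => /subr0_eq e; apply: nx; rewrite e.
rewrite orthocompl_closed_span in ow.
pose v := `|x - w|^-1 *: (x - w).
have vv : '[v, v] = 1.
  by rewrite -normr_inner normrZ normfV normr_id mulVf ?expr1n ?normr_eq0.
have ov : orthocompl (A `|` B) v by apply: subspaceZ ow; apply: subspace_orthocompl.
have nBv : ~ B v.
  by move=> Bv; move/eqP: (ov v (or_intror Bv)); rewrite vv oner_eq0.
apply: (maxB (B `|` [set v])).
  split; first by move=> u Bu; left.
  by move=> /(_ v (or_intror erefl)).
split; last by move=> u [/BW//|->]; apply: subspaceZ => //; apply: subspaceB.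
have ovN u : (A `|` B) u -> u <> v.
  by move=> ABu uv; move/eqP: (ov u ABu); rewrite uv vv oner_eq0.
rewrite setUA => u u' [ABu|->] [ABu'|->]; first exact: oB.
- by rewrite (inner_eq0C (ov _ ABu)) asboolF //; apply: ovN.
- by rewrite (ov _ ABu') asboolF // => /esym; apply: ovN.
- by rewrite vv asboolT.
Qed.

Lemma compatible_sym X Y : compatible X Y -> compatible Y X.
Proof. by case=> B oB [XB YB]; exists B. Qed.

Lemma compatible_orthoP X Y :
    subspace X -> closed X -> subspace Y -> closed Y ->
  compatible X Y <-> X `&` orthocompl (X `&` Y) `<=` orthocompl Y.
Proof.
move=> sX cX sY cY; split=> [[B [oB _] [[A AB <-] [A' A'B <-]]] x [Ax ox]|XY].
  rewrite orthocompl_closed_span => y A'y.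
  (* A basis vector of [Y] either belongs to the basis of [X], hence to the intersection, or is
     orthogonal to all of that basis. *)
  have [Ay|nAy] := pselect (A y).
    by apply: ox; split; apply: sub_closed_span.
  suff : orthocompl A y by rewrite -orthocompl_closed_span => /(_ _ Ax)/inner_eq0C.
  move=> z Az; rewrite oB ?asboolF //; [|exact: A'B|exact: AB].
  by move=> yz; apply: nAy; rewrite yz.
have [E [oE _ spE]] : exists E, [/\ orthonormal_set E, set0 `<=` E
    & closed_span E = X `&` Y].
  by apply: orthonormal_extend => //; [exact: subspaceI | exact: closedI].
have EXY : E `<=` X `&` Y by rewrite -spE; apply: sub_closed_span.
have [A [oA EA spA]] := orthonormal_extend sX cX oE (subset_trans EXY (@subIsetl _ _ _)).
have [A' [oA' EA' spA']] :=
  orthonormal_extend sY cY oE (subset_trans EXY (@subIsetr _ _ _)).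
(* A vector of [A] outside [E] is orthogonal to [E], hence to the intersection, and the hypothesis
   makes it orthogonal to [Y]. *)
have AA' u v : A u -> A' v -> '[u, v] = `[< u = v >]%:R.
  move=> Au A'v; have [Eu|nEu] := pselect (E u); first by apply: oA' => //; apply: EA'.
  have Xu : X u by rewrite -spA; apply: sub_closed_span.
  have Yv : Y v by rewrite -spA'; apply: sub_closed_span.
  have uv : '[u, v] = 0.
    apply: XY Yv; split=> //; rewrite -spE orthocompl_closed_span => w Ew.
    by rewrite oA ?asboolF//; [move=> uw; apply: nEu; rewrite uw | exact: EA].
  rewrite uv asboolF // => e; move/eqP: (oA u u Au Au).
  by rewrite asboolT // [X in '[_, X]]e uv eq_sym oner_eq0.
have oAA' : orthonormal_set (A `|` A').
  move=> u v [Au|A'u] [Av|A'v]; [exact: oA | exact: AA' | | exact: oA'].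
  rewrite innerC AA' // rmorph_nat; congr (_%:R).
  by apply: congr1; apply/asbool_equiv_eq; split=> ->.
have [B [oB AB spB]] := orthonormal_extend subspaceT closedT oAA' (@subsetT _ _).
exists B => //; split; [exists A | exists A'] => //.
  by move=> u Au; apply: AB; left.
by move=> u A'u; apply: AB; right.
Qed.

(** * Finite-dimensional subspaces *)

(** Coefficients form a row vector, so that subspaces of a span correspond to row spaces of
    matrices. *)
Definition lincomb n (e : 'I_n -> H) (v : 'rV[C]_n) : H :=
  \sum_(i < n) v ord0 i *: e i.

Lemma lincomb_is_linear n (e : 'I_n -> H) : linear (lincomb e).
Proof.
move=> a u v; rewrite /lincomb scaler_sumr -big_split; apply: eq_bigr => i _.
by rewrite !mxE scalerDl scalerA.
Qed.

HB.instance Definition _ n (e : 'I_n -> H) :=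
  GRing.isLinear.Build C 'rV[C]_n H _ (lincomb e) (@lincomb_is_linear n e).

Lemma lincomb_inj n (e : 'I_n -> H) : lin_indep e -> injective (lincomb e).
Proof.
move=> ie u v /eqP; rewrite -subr_eq0 -linearB => /eqP/ie uv0.
by apply/eqP; rewrite -subr_eq0; apply/eqP/rowP => i; rewrite uv0 !mxE.
Qed.

Lemma lin_indep_inj n (e : 'I_n -> H) :
  (forall v : 'rV_n, lincomb e v = 0 -> v = 0) -> lin_indep e.
Proof.
move=> ie c c0 i; suff /rowP/(_ i) : \row_j c j = 0 by rewrite !mxE.
by apply: ie; rewrite -{}[RHS]c0; apply: eq_bigr => j _; rewrite mxE.
Qed.

Lemma subspace_lincomb n (e : 'I_n -> H) : subspace (range (lincomb e)).
Proof.
apply/subspaceP; split; first by exists 0; rewrite ?linear0.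
by move=> a _ _ [u _ <-] [v _ <-]; exists (a *: u + v); rewrite ?linearP.
Qed.

Lemma lincomb_delta n (e : 'I_n -> H) i : lincomb e (delta_mx ord0 i) = e i.
Proof.
rewrite /lincomb (bigD1 i) //= big1 ?addr0 ?mxE ?eqxx ?scale1r //.
by move=> j /negbTE ji; rewrite mxE ji andbF scale0r.
Qed.

Lemma subspace_sum W n (c : 'I_n -> C) (e : 'I_n -> H) : subspace W ->
  (forall i, W (e i)) -> W (\sum_(i < n) c i *: e i).
Proof.
move=> sW We; apply: (big_ind W); first exact: subspace0.
  by move=> *; apply: subspaceD.
by move=> *; apply: subspaceZ.
Qed.

Lemma lin_span_range n (e : 'I_n -> H) : lin_span (range e) = range (lincomb e).
Proof.
apply/seteqP; split.
  apply: lin_span_sub; first exact: subspace_lincomb.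
  by move=> _ [i _ <-]; exists (delta_mx ord0 i); rewrite ?lincomb_delta.
move=> _ [v _ <-]; apply: subspace_sum; first exact: subspace_lin_span.
by move=> i; apply: sub_lin_span; exists i.
Qed.

Lemma has_dim_lincomb n W : has_dim n W <->
  exists2 e : 'I_n -> H, lin_indep e & W = range (lincomb e).
Proof. by split=> -[e ie We]; exists e => //; rewrite -?We lin_span_range. Qed.

Lemma has_dim_subspace n W : has_dim n W -> subspace W.
Proof. by case=> e _ <-; apply: subspace_lin_span. Qed.

(** * Subspaces as row spaces in coordinates *)

(** Among the matrices with row space inside [K], one of maximal rank is taken: adjoining a vector
    of [K] cannot raise the rank, so this vector is already in the row space. *)
Lemma rowspace_exists n (K : set 'rV[C]_n) :
    K 0 -> (forall a (u v : 'rV_n), K u -> K v -> K (a *: u + v)) ->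
  exists M : 'M[C]_n, forall v : 'rV_n, K v <-> (v <= M)%MS.
Proof.
move=> K0 KD.
pose P (r : nat) := `[< exists M : 'M[C]_n,
  \rank M = r /\ forall v : 'rV_n, (v <= M)%MS -> K v >].
have P0 : P 0%N.
  apply/asboolP; exists 0; rewrite mxrank0; split=> [//|v].
  by rewrite submx0 => /eqP ->.
have Pn r : P r -> (r <= n)%N.
  by move=> /asboolP[M [<- _]]; apply: rank_leq_col.
have exP : exists r, P r by exists 0%N.
case: (ex_maxnP exP Pn) => r /asboolP[M [<- MK]] maxM.
exists M => v; split; last exact: MK.
move=> Kv.
have : P (\rank (M + v)%MS).
  apply/asboolP; exists (M + v)%MS; split=> [//|w] /sub_addsmxP[[p q] /= ->].
  rewrite addrC [q]mx11_scalar.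
  by rewrite mul_scalar_mx; apply: KD => //; apply: MK; apply: submxMl.
move=> /maxM le; apply: submx_trans (addsmxSr M v) _.
by rewrite -(geq_leqif (mxrank_leqif_sup (addsmxSl M v))).
Qed.

Definition mxspace n m (e : 'I_n -> H) (M : 'M[C]_(m, n)) : set H :=
  lincomb e @` [set v | (v <= M)%MS].

Lemma mxspace_exists n (e : 'I_n -> H) W : subspace W -> W `<=` range (lincomb e) ->
  exists M : 'M[C]_n, W = mxspace e M.
Proof.
move=> /subspaceP[W0 WD] We.
have [||M MP] := @rowspace_exists n (lincomb e @^-1` W).
- by rewrite /preimage /= linear0.
- by move=> a u v Wu Wv; rewrite /preimage /= linearP; apply: WD.
exists M; apply/seteqP; split=> [x Wx|_ [v /MP Wv <-]] //.
by have [v _ vx] := We x Wx; exists v => //; apply/MP; rewrite /preimage /= vx.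
Qed.

Lemma has_dim_mxspace n m (e : 'I_n -> H) (M : 'M[C]_(m, n)) : lin_indep e ->
  has_dim (\rank M) (mxspace e M).
Proof.
move=> ie; pose f i := lincomb e (row i (row_base M)).
have fE (v : 'rV[C]_(\rank M)) : lincomb f v = lincomb e (v *m row_base M).
  rewrite mulmx_sum_row linear_sum; apply: eq_bigr => i _.
  by rewrite linearZ.
apply/has_dim_lincomb; exists f.
  apply: lin_indep_inj => v; rewrite fE -(linear0 (lincomb e)) => /(lincomb_inj ie).
  by move=> /eqP; rewrite mulmx_free_eq0 ?row_base_free // => /eqP.
apply/seteqP; split=> [_ [v /= vM <-]|_ [v _ <-]].
  rewrite -(eq_row_base M) in vM; have /submxP[w ->] := vM.
  by exists w => //; rewrite fE.
by exists (v *m row_base M); rewrite ?fE //= -(eq_row_base M) submxMl.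
Qed.

(** The matrix expressing a basis of [X] in a basis of [Y] has independent rows; if it is square,
    its rows span everything. *)
Lemma has_dim_leq m n X Y : has_dim m X -> has_dim n Y -> X `<=` Y ->
  (m <= n)%N /\ (m = n -> X = Y).
Proof.
move=> /has_dim_lincomb[e ie ->] /has_dim_lincomb[f if_ ->] XY.
have /choice[A Af] i : exists v : 'rV[C]_n, lincomb f v = e i.
  have [|v _ ve] := XY (e i); last by exists v.
  by exists (delta_mx ord0 i); rewrite ?lincomb_delta.
pose M := \matrix_i A i.
have ME (v : 'rV[C]_m) : lincomb e v = lincomb f (v *m M).
  rewrite mulmx_sum_row linear_sum; apply: eq_bigr => i _.
  by rewrite linearZ rowK /= Af.
have fM : row_free M.
  rewrite -kermx_eq0; apply: contraT => /rowV0Pn[v /sub_kermxP vM].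
  suff -> : v = 0 by rewrite eqxx.
  by apply: (lincomb_inj ie); rewrite ME vM !linear0.
split=> [|mn]; first by rewrite -(eqP fM) rank_leq_col.
apply/seteqP; split=> // _ [v _ <-].
have : row_full M by rewrite /row_full (eqP fM) mn.
move=> /(submx_full v)/submxP[w ->].
by exists w => //; rewrite ME.
Qed.

Lemma has_dim_uniq m n W : has_dim m W -> has_dim n W -> m = n.
Proof.
move=> Wm Wn; apply/eqP; rewrite eqn_leq.
by rewrite (has_dim_leq Wm Wn _).1 // (has_dim_leq Wn Wm _).1.
Qed.

Lemma has_dim_sub n W V : subspace W -> has_dim n V -> W `<=` V ->
  exists m, has_dim m W.
Proof.
move=> sW /has_dim_lincomb[e ie ->] /(mxspace_exists sW)[M ->].
by exists (\rank M); apply: has_dim_mxspace.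
Qed.

(** * Sums, intersections and the dimension formula *)

Definition sumset X Y : set H := [set x + y | x in X & y in Y].

(** This provides common coordinates for two subspaces. The concatenated family [h] may be
    dependent; [K] is its space of relations, and [h] maps a basis of a complement of [K] to an
    independent family with the same span. *)
Lemma sumset_lincomb m n (e : 'I_m -> H) (f : 'I_n -> H) :
  exists p (g : 'I_p -> H),
    lin_indep g /\ sumset (range (lincomb e)) (range (lincomb f)) `<=` range (lincomb g).
Proof.
pose h i := match fintype.split i with inl j => e j | inr j => f j end.
have hE (u : 'rV[C]_m) (v : 'rV[C]_n) :
    lincomb h (row_mx u v) = lincomb e u + lincomb f v.
  rewrite /lincomb big_split_ord; congr (_ + _); apply: eq_bigr => i _ /=.
    by rewrite row_mxEl /h (unsplitK (inl i)).
  by rewrite row_mxEr /h (unsplitK (inr i)).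
have [||K KP] := @rowspace_exists (m + n) (lincomb h @^-1` [set 0]).
- by rewrite /preimage /= linear0.
- by move=> a u v /= hu hv; rewrite linearP /= hu hv scaler0 addr0.
pose g i := lincomb h (row i (row_base K^C%MS)).
have gE (v : 'rV[C]_(\rank K^C)) : lincomb g v = lincomb h (v *m row_base K^C%MS).
  rewrite mulmx_sum_row linear_sum; apply: eq_bigr => i _.
  by rewrite linearZ.
exists (\rank K^C), g; split.
  apply: lin_indep_inj => v; rewrite gE => /KP vK.
  have : (v *m row_base K^C%MS <= K :&: K^C)%MS.
    by rewrite sub_capmx vK /= -(eq_row_base K^C%MS) submxMl.
  rewrite capmx_compl submx0 mulmx_free_eq0 ?row_base_free //.
  by move=> /eqP.
move=> _ [_ [u _ <-] [_ [v _ <-] <-]]; rewrite -hE.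
have /(submx_full (row_mx u v)) := addsmx_compl_full K.
move=> /sub_addsmxP[[p q] /= ->]; rewrite linearD /=.
have -> : lincomb h (p *m K) = 0 by apply/KP; rewrite submxMl.
have /submxP[w ->] : (q *m K^C <= row_base K^C)%MS by rewrite eq_row_base submxMl.
by exists w => //; rewrite gE add0r.
Qed.

(** In common coordinates [g], sum and intersection become those of row spaces, and the formula is
    the one for matrix ranks. *)
Lemma has_dim_sum_cap m n X Y : has_dim m X -> has_dim n Y ->
  exists p q, [/\ has_dim p (sumset X Y), has_dim q (X `&` Y) & (p + q = m + n)%N].
Proof.
move=> Xm Yn.
have [p [g [ig sg]]] : exists p (g : 'I_p -> H), lin_indep g /\
    sumset X Y `<=` range (lincomb g).
  move/has_dim_lincomb: Xm => [e _ ->]; move/has_dim_lincomb: Yn => [f _ ->].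
  exact: sumset_lincomb.
have sX := has_dim_subspace Xm; have sY := has_dim_subspace Yn.
have [|A AX] := @mxspace_exists p g X sX.
  move=> x Xx; apply: sg; exists x => //.
  by exists 0; rewrite ?addr0 //; apply: subspace0.
have [|B BY] := @mxspace_exists p g Y sY.
  by move=> y Yy; apply: sg; exists 0; [apply: subspace0|exists y; rewrite ?add0r].
exists (\rank (A + B)%MS), (\rank (A :&: B)%MS); split.
- suff -> : sumset X Y = mxspace g (A + B)%MS by apply: has_dim_mxspace.
  rewrite AX BY; apply/seteqP; split.
    move=> _ [_ [u /= uA <-] [_ [v /= vB <-] <-]].
    by exists (u + v); rewrite /= ?linearD // addmx_sub_adds.
  move=> _ [_ /= /sub_addsmxP[[u v] -> <-]] /=; rewrite linearD /=.
  exists (lincomb g (u *m A)); first by exists (u *m A) => //=; apply: submxMl.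
  by exists (lincomb g (v *m B)) => //; exists (v *m B) => //=; apply: submxMl.
- suff -> : X `&` Y = mxspace g (A :&: B)%MS by apply: has_dim_mxspace.
  rewrite AX BY; apply/seteqP; split.
    move=> x [[u /= uA <-] [v /= vB /(lincomb_inj ig) vu]].
    by exists u => //=; rewrite sub_capmx uA -vu.
  by move=> x [v /=]; rewrite sub_capmx => /andP[vA vB] <-; split; exists v.
- rewrite mxrank_sum_cap; congr (_ + _)%N.
    by apply: has_dim_uniq Xm; rewrite AX; apply: has_dim_mxspace.
  by apply: has_dim_uniq Yn; rewrite BY; apply: has_dim_mxspace.
Qed.

Lemma has_dim0 : has_dim 0 [set 0 : H].
Proof.
apply/has_dim_lincomb; exists (fun _ : 'I_0 => 0).
  by move=> c _ [].
apply/seteqP; split=> [_ ->|_ [v _ <-]] /=; first by exists 0; rewrite // linear0.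
by rewrite /lincomb big_ord0.
Qed.

Definition line y : set H := range (fun c : C => c *: y).

Lemma has_dim_line y : y != 0 -> has_dim 1 (line y).
Proof.
move=> y0; apply/has_dim_lincomb; exists (fun=> y).
  move=> c; rewrite big_ord1 => /eqP; rewrite scaler_eq0 (negbTE y0) orbF => /eqP c0 i.
  by rewrite ord1.
apply/seteqP; split=> [_ [c _ <-]|_ [v _ <-]].
  by exists (const_mx c) => //; rewrite /lincomb big_ord1 mxE.
by exists (v ord0 ord0); rewrite // /lincomb big_ord1.
Qed.

Lemma has_dim_adjoin n A y : has_dim n A -> ~ A y ->
  has_dim n.+1 (sumset A (line y)).
Proof.
move=> An nAy; have sA := has_dim_subspace An.
have y0 : y != 0 by apply/eqP => y0; apply: nAy; rewrite y0; apply: subspace0.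
have [p [q [Sp Iq]]] := has_dim_sum_cap An (has_dim_line y0).
suff I0 : A `&` line y = [set 0].
  rewrite I0 in Iq; rewrite (has_dim_uniq Iq has_dim0) addn0 addn1 => pn.
  by rewrite -pn.
apply/seteqP; split=> [x [Ax [c _ cx]]|_ ->] /=; last first.
  by split; [apply: subspace0 | exists 0; rewrite ?scale0r].
rewrite -{x}cx in Ax *; have [->|c0] := eqVneq c 0; first by rewrite scale0r.
by case: nAy; rewrite -[y](scalerK c0); apply: subspaceZ.
Qed.

Lemma sumset_line_sub A y W : subspace W -> A `<=` W -> W y ->
  sumset A (line y) `<=` W.
Proof.
move=> sW AW Wy _ [a Aa [_ [c _ <-] <-]].
by apply: subspaceD => //; [apply: AW | apply: subspaceZ].
Qed.

Lemma sumset_linel A y : A `<=` sumset A (line y).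
Proof.
move=> a Aa; exists a => //; exists 0; rewrite ?addr0 //.
by exists 0; rewrite ?scale0r.
Qed.

Lemma sumset_liner A y : subspace A -> sumset A (line y) y.
Proof.
move=> sA; exists 0; first exact: subspace0.
by exists y; rewrite ?add0r //; exists 1; rewrite ?scale1r.
Qed.

(* If [x] were a limit point of [X] outside [X], the space spanned by [X] and
   [x] would contain a nonzero vector orthogonal to [X], hence to itself. *)
Lemma has_dim_closed k X : has_dim k X -> closed X.
Proof.
move=> Xk x clx; apply: contrapT => nXx.
have sX := has_dim_subspace Xk.
have /has_dim_lincomb[f if_ fV] := has_dim_adjoin Xk nXx.
have /has_dim_lincomb[e ie eX] := Xk.
pose G := \matrix_(i, j) '[f i, e j].
(* The Gram matrix [G] has [k.+1] rows and [k] columns, so some nonzero combination of its rows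
   vanishes. *)
have : kermx G != 0.
  rewrite -mxrank_eq0 mxrank_ker subn_eq0 -ltnNge ltnS.
  exact: rank_leq_col.
case/rowV0Pn => v /sub_kermxP vG v0.
pose u := lincomb f v.
have uX : orthocompl (closure X) u.
  rewrite eX -lin_span_range orthocompl_closed_span => _ [j _ <-].
  have /rowP/(_ j) := vG; rewrite !mxE => <-.
  rewrite linear_sumlz; apply: eq_bigr => i _.
  by rewrite [G i j]mxE; apply: innerZl.
have clu : closure X u.
  have : range (lincomb f) u by exists v.
  rewrite -fV; apply: sumset_line_sub => //; first exact: subspace_closure.
  exact: subset_closure.
case/eqP: v0; apply: (lincomb_inj if_); rewrite linear0.
by apply: orthocompl_self => _ ->; apply: uX.
Qed.

End HilbertSpace.

(** * Geodesics of the Grassmann graphs *)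

Section GrassmannGraph.
Local Open Scope classical_set_scope.
Local Open Scope ring_scope.

Variables (R : realType) (H : hilbertType R) (k : nat).
Implicit Types (X Y Z : grassmannian H k).

(** The dimension proof stored in a vertex is irrelevant. *)
Lemma grassmannian_inj X Y : subspace_set X = subspace_set Y -> X = Y.
Proof.
case: X Y => [X dX] [Y dY] /= XY; rewrite XY in dX *.
by rewrite (Prop_irrelevance dX dY).
Qed.

Let sub_grass X : subspace X := has_dim_subspace (subspace_dim X).
Let closed_grass X : closed X := has_dim_closed (subspace_dim X).

(** * Dimension of intersections and distance in the Grassmann graph *)

(** The default [0] is never reached, since the intersection always has a dimension. *)
Definition capdim X Y : nat := xget 0%N [set q | has_dim q (X `&` Y)].

Lemma has_dim_cap X Y : has_dim (capdim X Y) (X `&` Y).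
Proof.
have [q Iq] := has_dim_sub (subspaceI (sub_grass X) (sub_grass Y)) (subspace_dim X)
  (@subIsetl _ _ _).
exact: (@xgetI _ 0%N (fun q => has_dim q (X `&` Y)) q Iq).
Qed.

Lemma capdim_sym X Y : capdim X Y = capdim Y X.
Proof. by rewrite /capdim setIC. Qed.

Lemma capdim_leq X Y : (capdim X Y <= k)%N.
Proof. exact: (has_dim_leq (has_dim_cap X Y) (subspace_dim X) (@subIsetl _ _ _)).1. Qed.

Lemma capdimXX X : capdim X X = k.
Proof.
by apply: has_dim_uniq (has_dim_cap X X) _; rewrite setIid; apply: subspace_dim.
Qed.

Lemma capdim_eq X Y : capdim X Y = k -> X = Y.
Proof.
move=> XY; apply: grassmannian_inj.
rewrite -((has_dim_leq (has_dim_cap X Y) (subspace_dim X) (@subIsetl _ _ _)).2 XY).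
exact: ((has_dim_leq (has_dim_cap X Y) (subspace_dim Y) (@subIsetr _ _ _)).2 XY).
Qed.

Lemma grassmann_graphP X Y : reflect (capdim X Y = k.-1) (grassmann_graph X Y).
Proof.
apply: (iffP (asboolP _)) => [|XY]; first exact: has_dim_uniq (has_dim_cap X Y).
by rewrite /Defs.adjacent -XY; apply: has_dim_cap.
Qed.

(** The dimension formula inside [Y]. Both bounds are kept apart: when they are attained, the sum is
    all of [Y] and the triple intersection is that of [X] and [Z]. *)
Lemma has_dim_sum_caps X Y Z : exists p q,
  [/\ has_dim p (sumset (X `&` Y) (Y `&` Z)), has_dim q (X `&` Y `&` (Y `&` Z)),
      (p <= k)%N, (q <= capdim X Z)%N & (p + q = capdim X Y + capdim Y Z)%N].
Proof.
have [p [q [Sp Iq pq]]] := has_dim_sum_cap (has_dim_cap X Y) (has_dim_cap Y Z).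
exists p, q; split=> //.
  apply: (has_dim_leq Sp (subspace_dim Y) _).1 => _ [a [_ Ya] [b [Yb _] <-]].
  exact: subspaceD.
by apply: (has_dim_leq Iq (has_dim_cap X Z) _).1 => a [[Xa _] [_ Za]].
Qed.

(** This is the triangle inequality for [k - capdim]. *)
Lemma capdim_triangle X Y Z : (capdim X Y + capdim Y Z <= capdim X Z + k)%N.
Proof. by have [p [q [_ _ ? ? <-]]] := has_dim_sum_caps X Y Z; lia. Qed.

Lemma leq_path_size X Y p : connecting_path (@grassmann_graph R H k) X Y p ->
  (k - capdim X Y <= size p)%N.
Proof.
elim: p X => [|Z p IHp] X [/=]; first by move=> _ <-; rewrite capdimXX subnn.
move=> /andP[/grassmann_graphP XZ Zp] pY.
have := IHp Z (conj Zp pY); have := capdim_triangle X Z Y; have := capdim_leq Z Y.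
lia.
Qed.

(** [Z] is spanned by [y] and the orthocomplement [A] of [x] in [X]. As [x] is orthogonal to the
    intersection of [X] and [Y], [A] contains it; so [Z] meets [Y] in one more dimension, and the
    triangle inequality excludes further ones. *)
Lemma grassmann_step X Y (x y : H) :
    subspace_set X x -> x != 0 -> orthocompl (X `&` Y) x ->
    subspace_set Y y -> ~ subspace_set X y ->
  exists Z, [/\ grassmann_graph X Z, capdim Z Y = (capdim X Y).+1,
    X `&` Z `<=` orthocompl [set x] & subspace_set Z y].
Proof.
move=> Xx x0 ox Yy nXy; pose A := X `&` orthocompl [set x].
have sA : subspace A by apply: subspaceI => //; apply: subspace_orthocompl.
have nAx : ~ A x by move=> [_ /orthocompl_self/eqP]; rewrite (negbTE x0).
have [m Am] := has_dim_sub sA (subspace_dim X) (@subIsetl _ _ _).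
have mk : m.+1 = k.
  apply: has_dim_uniq (has_dim_adjoin Am nAx) _.
  suff -> : sumset A (line x) = X by apply: subspace_dim.
  apply/seteqP; split; first by apply: sumset_line_sub => //; apply: subIsetl.
  (* Removing from [u] its component along [x] leaves a vector of [A]. *)
  move=> u Xu; pose c := inner H u x / inner H x x.
  exists (u - c *: x); last by exists (c *: x); [exists c | rewrite subrK].
  split; first by apply: subspaceB => //; apply: subspaceZ.
  by move=> _ ->; rewrite innerBl innerZl divfK ?subrr // dnorm_eq0.
have nAy : ~ A y by case.
have Zk : has_dim k (sumset A (line y)) by rewrite -mk; apply: has_dim_adjoin.
pose Z := Subspace Zk.
have XZ : X `&` Z = A.
  apply/seteqP; split=> [u [Xay /= [a [Xa oa] [_ [c _ <-] e]]]|a Aa]; last first.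
    by split; [case: Aa | apply: sumset_linel].
  (* If [a + c *: y] is in [X], so is [c *: y], and [c = 0] because [y] is not in [X]. *)
  rewrite -{u}e in Xay *; have Xcy : subspace_set X (c *: y).
    by rewrite -[c *: y](addKr a) addrC; apply: subspaceB.
  have [->|c0] := eqVneq c 0; first by rewrite scale0r addr0.
  by case: nXy; rewrite -[y](scalerK c0); apply: subspaceZ.
have XZd : capdim X Z = k.-1.
  by apply: has_dim_uniq (has_dim_cap X Z) _; rewrite XZ -mk.
exists Z; split; [exact/grassmann_graphP | | by rewrite XZ; apply: subIsetr | ].
  have ZYd : (capdim X Y < capdim Z Y)%N.
    have nIy : ~ (X `&` Y) y by case.
    apply: (has_dim_leq (has_dim_adjoin (has_dim_cap X Y) nIy) (has_dim_cap Z Y) _).1.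
    apply: sumset_line_sub; first exact: subspaceI.
      move=> a [Xa Ya]; split=> //; apply: sumset_linel; split=> // _ ->.
      by apply: inner_eq0C; apply: ox.
    by split=> //; apply: sumset_liner.
  by have := capdim_triangle X Z Y; lia.
exact: sumset_liner.
Qed.

Lemma capdim_lt X Y : (capdim X Y < k)%N ->
  exists2 y, subspace_set Y y & ~ subspace_set X y.
Proof.
move=> lt; apply: contrapT => no.
suff e : Y `&` X = Y.
  move: lt; rewrite capdim_sym (@has_dim_uniq _ _ (capdim Y X) k Y) ?ltnn //.
    by rewrite -e; apply: has_dim_cap.
  exact: subspace_dim.
apply/seteqP; split=> [y []|y Yy] //; split=> //; apply: contrapT => nXy.
by apply: no; exists y.
Qed.

Lemma grassmann_path_exists X Y :
  exists2 p, connecting_path (@grassmann_graph R H k) X Y p & size p = (k - capdim X Y)%N.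
Proof.
have [n] := ubnP (k - capdim X Y); elim: n => // n IHn in X *.
rewrite ltnS => le.
have [/eqP|lt] := boolP (capdim X Y == k).
  by move=> XY; exists [::]; rewrite ?XY ?subnn // -(capdim_eq XY).
have {}lt : (capdim X Y < k)%N by rewrite ltn_neqAle lt capdim_leq.
have [y Yy nXy] := capdim_lt lt.
have [z Xz nYz] : exists2 z, subspace_set X z & ~ subspace_set Y z.
  by apply: capdim_lt; rewrite capdim_sym.
have [w [Xw Yw] ow] := closed_projection z
  (subspaceI (sub_grass X) (sub_grass Y)) (closedI (@closed_grass X) (@closed_grass Y)).
(* The vector [z - w] of [X] is orthogonal to the intersection, and nonzero because [w] is in [Y]
   and [z] is not. *)
have [||Z [XZ ZY _ _]] := @grassmann_step X Y (z - w) y _ _ ow Yy nXy.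
- exact: subspaceB.
- by apply/eqP => /subr0_eq e; apply: nYz; rewrite e.
have [|p [Zp pY] ps] := IHn Z; first by rewrite ZY; lia.
exists (Z :: p); first by split=> //=; rewrite XZ.
by rewrite /= ps ZY; lia.
Qed.

(** The lower bound on path lengths is attained, so the distance is [k - capdim X Y]. *)
Lemma grassmann_geodesicP X Y p : geodesic (@grassmann_graph R H k) X Y p <->
  connecting_path (@grassmann_graph R H k) X Y p /\ size p = (k - capdim X Y)%N.
Proof.
have [q XqY qs] := grassmann_path_exists X Y.
split=> [[XpY [_ min_p]]|[XpY ps]]; split=> //.
  by apply/eqP; rewrite eqn_leq -{1}qs min_p // leq_path_size.
split; first by exists p.
by move=> r /leq_path_size; rewrite ps.
Qed.

(** * Compatibility along geodesics *)

Lemma compatible_grassP X Y :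
  compatible X Y <-> X `&` orthocompl (X `&` Y) `<=` orthocompl Y.
Proof. exact: compatible_orthoP. Qed.

(** An edge raises the intersection dimension with [Y] by at most one, so on a geodesic each edge
    must raise it by exactly one. *)
Lemma grassmann_geodesic_cons X Y Z p :
  geodesic (@grassmann_graph R H k) X Y (Z :: p) ->
  [/\ grassmann_graph X Z, capdim Z Y = (capdim X Y).+1
     & geodesic (@grassmann_graph R H k) Z Y p].
Proof.
move=> /grassmann_geodesicP[[/= /andP[XZ Zp] pY] ps].
have ZY : (k - capdim Z Y <= size p)%N by apply: leq_path_size.
have tri := capdim_triangle X Z Y; have /grassmann_graphP XZd := XZ.
have ZYk := capdim_leq Z Y.
have e : capdim Z Y = (capdim X Y).+1 by lia.
by split=> //; apply/grassmann_geodesicP; split=> //; lia.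
Qed.

Lemma compatible_geodesic_step X Y Z : (0 < k)%N -> compatible X Y ->
    grassmann_graph X Z -> capdim Z Y = (capdim X Y).+1 ->
  compatible X Z /\ compatible Z Y.
Proof.
move=> k_gt0 XY /grassmann_graphP XZ ZY.
(* Here [p + q = k.-1 + (capdim X Y).+1], which is [k + capdim X Y] as [0 < k]; hence both bounds
   [p <= k] and [q <= capdim X Y] are equalities. *)
have [p [q [Sp Iq pk qI pq]]] := has_dim_sum_caps X Z Y.
have S_sub : sumset (X `&` Z) (Z `&` Y) `<=` Z.
  by move=> _ [a [_ Za] [b [Zb _] <-]]; apply: subspaceD.
have SZ : sumset (X `&` Z) (Z `&` Y) = Z.
  by apply: (has_dim_leq Sp (subspace_dim Z) S_sub).2; lia.
have I_sub : X `&` Z `&` (Z `&` Y) `<=` X `&` Y by move=> a [[Xa _] [_ Ya]].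
have IE : X `&` Z `&` (Z `&` Y) = X `&` Y.
  by apply: (has_dim_leq Iq (has_dim_cap X Y) I_sub).2; lia.
have IZ : X `&` Y `<=` Z by rewrite -IE => a [[_ Za] _].
split.
  (* In [z = a + b], [x] is orthogonal to [a] by assumption, and to [b] by compatibility of [X] and
     [Y], whose intersection lies in [Z]. *)
  apply/compatible_grassP => x [Xx ox] z; rewrite -SZ => -[a Ia [b [_ Yb] <-]].
  rewrite innerDr (ox a) // add0r; apply: ((compatible_grassP X Y).1 XY) Yb.
  by split=> // a' [Xa' Ya']; apply: ox; split=> //; apply: IZ.
apply/compatible_sym/compatible_grassP => y [Yy oy] z.
rewrite -SZ => -[a [Xa _] [b [Zb Yb] <-]].
rewrite innerDr (oy b) // addr0.
apply: ((compatible_grassP Y X).1 (compatible_sym XY)) Xa.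
by split=> // a' [Ya' Xa']; apply: oy; split=> //; apply: IZ.
Qed.

Lemma compatible_geodesic X Y p : (0 < k)%N -> compatible X Y ->
    geodesic (@grassmann_graph R H k) X Y p ->
  connecting_path (@ortho_grassmann_graph R H k) X Y p.
Proof.
move=> k_gt0; elim: p X => [|Z p IHp] X XY; first by case=> -[_ <-].
move=> /grassmann_geodesic_cons[XZ ZY Zp].
have [cXZ cZY] := compatible_geodesic_step k_gt0 XY XZ ZY.
have [pp pY] := IHp Z cZY Zp.
split=> //=; rewrite pp andbT; apply/asboolP; split=> //.
exact/asboolP.
Qed.

Lemma ortho_connecting_path X Y p :
  connecting_path (@ortho_grassmann_graph R H k) X Y p ->
  connecting_path (@grassmann_graph R H k) X Y p.
Proof.
case=> pp pY; split=> //; apply: sub_path pp => Z W /asboolP[ZW _].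
exact/asboolP.
Qed.

Lemma geodesics_ortho_compatible X Y :
  (forall p, geodesic (@grassmann_graph R H k) X Y p ->
     connecting_path (@ortho_grassmann_graph R H k) X Y p) ->
  compatible X Y.
Proof.
move=> geo; apply/compatible_grassP => x [Xx ox] y Yy.
have [Xy|nXy] := pselect (subspace_set X y); first exact: ox.
have [->|x0] := eqVneq x 0; first exact: inner0l.
have [Z [XZ ZY oZ Zy]] := grassmann_step Xx x0 ox Yy nXy.
have [p [Zp pY] ps] := grassmann_path_exists Z Y.
(* A shortest path from [Z] to [Y] is prolonged to a geodesic from [X], whose first edge must then
   be ortho-adjacent. *)
have /geo[/= /andP[/asboolP[_ cXZ] _] _] : geodesic (@grassmann_graph R H k) X Y (Z :: p).
  apply/grassmann_geodesicP; split; first by split=> //=; rewrite XZ.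
  by rewrite /= ps; have := capdim_leq Z Y; lia.
apply: ((compatible_grassP X Z).1 cXZ) Zy; split=> // a XZa.
by apply/inner_eq0C; apply: oZ XZa _ erefl.
Qed.

End GrassmannGraph.

Theorem theorem3 (R : realType) (H : hilbertType R) (k : nat)
    (dimH_ge3 : dim_ge H 3) (k_gt0 : (0 < k)%N) (k_lt_dimH : dim_ge H k.+1)
    (X Y : grassmannian H k) :
  compatible X Y <->
  (forall p : seq (grassmannian H k),
     geodesic (@grassmann_graph R H k) X Y p ->
     geodesic (@ortho_grassmann_graph R H k) X Y p).
Proof.
split=> [XY p gp|geo]; last first.
  by apply: geodesics_ortho_compatible => p /geo[].
have op := compatible_geodesic k_gt0 XY gp.
(* Ortho-Grassmann paths are Grassmann paths, so the minimality of [p] carries over. *)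
case: gp => _ [_ min_p]; split=> //; split; first by exists p.
by move=> q /ortho_connecting_path/min_p.
Qed.
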